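(* Let $P$ be a connected poset such that $\check{P}$ is ranked. Then $\mathcal{L}(P)$ is $2$-Gorenstein.
   Context: All posets are finite. For a poset $(P,\preceq)$, $a \lessdot b$ denotes a cover relation, and $\check{P} = P \cup \{\hat 0\}$ is $P$ with a new minimum $\hat 0$ adjoined (even if $P$ already has a minimum). A poset is connected if its Hasse diagram is connected. A poset is ranked if for all elements $a,b$ all maximal chains in the interval $[a,b]$ have the same length. Lipschitz polytope: $\mathcal{L}(P) \subset \mathbb{R}^P$ is the set of all $f : P \to \mathbb{R}$ with $0 \le f(a) \le 1$ for every minimal element $a$ of $P$ and $0 \le f(b)-f(a) \le 1$ for every cover relation $a \lessdot b$ in $P$. It is a full-dimensional lattice polytope with respect to $\mathbb{Z}^P$. A full-dimensional lattice polytope $\mathcal{P} \subset \mathbb{R}^n$ is reflexive if $\mathbf{0}$ is the only lattice point in its interior and its polar polytope $\{\mathbf{y} : \langle \mathbf{y},\mathbf{x}\rangle \le 1 \text{ for all } \mathbf{x} \in \mathcal{P}\}$ is again a lattice polytope. A lattice polytope $\mathcal{P}$ is $r$-Gorenstein, for $r \in \mathbb{Z}_{>0}$, if $r\mathcal{P}$ contains a unique lattice point $\mathbf{q}$ in its interior and $r\mathcal{P} - \mathbf{q}$ is reflexive. *)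

(* Defs.v *)
From HB Require Import structures.
From mathcomp Require Import all_boot all_order all_algebra.
From mathcomp Require Import all_classical all_reals all_analysis.

Set Implicit Arguments.
Unset Strict Implicit.
Unset Printing Implicit Defensive.

Import Order.TTheory GRing.Theory Num.Theory.
(* Equips I -> R^o with the product topology. *)
Import ArrowAsProduct.
Import numFieldNormedType.Exports.

Local Open Scope ring_scope.

Section Posets.
Context {d : Order.disp_t} {P : finPOrderType d}.
Implicit Types (a b c : P) (C : {set P}).

Definition covers a b : bool :=
  (a < b)%O && ~~ [exists c : P, (a < c < b)%O].

Definition minimal_elt a : bool := ~~ [exists b : P, (b < a)%O].

Definition connected_poset : Prop :=
  forall a b, connect (fun x y : P => covers x y || covers y x) a b.

Definition is_chain C : bool := [forall x in C, forall y in C, (x >=< y)%O].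

Definition maximal_chain a b C : bool :=
  maxset (fun D => (D \subset [set c : P | (a <= c <= b)%O]) && is_chain D) C.

(* The length of a chain is the number of its elements minus one. *)
Definition ranked : Prop :=
  forall a b C D, maximal_chain a b C -> maximal_chain a b D ->
    #|C|.-1 = #|D|.-1.

End Posets.
Arguments connected_poset {d} P.
Arguments ranked {d} P.

(* P with a new minimum None adjoined below every element, including a minimum
   of P if there is one. *)
Definition adjoin_bot (P : Type) : Type := option P.

HB.instance Definition _ (P : finType) := Finite.on (adjoin_bot P).

Section AdjoinBot.
Context {d : Order.disp_t} {P : finPOrderType d}.

Definition adjoin_bot_le (x y : adjoin_bot P) : bool :=
  match x, y with
  | None, _ => true
  | Some _, None => false
  | Some a, Some b => (a <= b)%O
  end.

Fact adjoin_bot_le_refl : reflexive adjoin_bot_le.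
Proof. by case=> [a|] //=; exact: lexx. Qed.

Fact adjoin_bot_le_anti : antisymmetric adjoin_bot_le.
Proof. by move=> [a|] [b|] //= /le_anti ->. Qed.

Fact adjoin_bot_le_trans : transitive adjoin_bot_le.
Proof. by move=> [b|] [a|] [c|] //=; exact: le_trans. Qed.

HB.instance Definition _ := Order.Le_isPOrder.Build d (adjoin_bot P)
  adjoin_bot_le_refl adjoin_bot_le_anti adjoin_bot_le_trans.

End AdjoinBot.

Local Open Scope classical_set_scope.

(* R^I is the type I -> R^o; the copy R^o of R makes it an lmodType. *)
Section Polytopes.
Context {R : realType} {I : finType}.
Implicit Types (A S : set (I -> R^o)) (x y q : I -> R^o).

Definition lattice : set (I -> R^o) :=
  [set x | forall i, (x i : R) \is a Num.int].

Definition convex_hull S : set (I -> R^o) :=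
  smallest (@convex_set R (I -> R^o)) S.

Definition affine_set A : Prop :=
  forall x y (t : R), A x -> A y -> A (t *: x + (1 - t) *: y).

Definition affine_hull S : set (I -> R^o) := smallest affine_set S.

Definition full_dimensional A : Prop := affine_hull A = setT.

Definition lattice_polytope A : Prop :=
  exists S, [/\ finite_set S, S `<=` lattice & A = convex_hull S].

Definition polar A : set (I -> R^o) :=
  [set y | forall x, A x -> \sum_i (y i : R) * x i <= 1].

Definition reflexive_polytope A : Prop :=
  [/\ lattice_polytope A, full_dimensional A,
      lattice `&` A° = [set 0] & lattice_polytope (polar A)].

Definition dilate (r : nat) A : set (I -> R^o) := [set r%:R *: x | x in A].

Definition translate A q : set (I -> R^o) := [set x + q | x in A].

Definition gorenstein (r : nat) A : Prop :=
  [/\ (0 < r)%N, lattice_polytope A &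
      exists q, lattice `&` (dilate r A)° = [set q] /\
                reflexive_polytope (translate (dilate r A) (- q))].

End Polytopes.

Definition lipschitz_polytope (R : realType) (d : Order.disp_t)
    (P : finPOrderType d) : set (P -> R^o) :=
  [set f | (forall a : P, minimal_elt a -> 0 <= (f a : R) <= 1) /\
           (forall a b : P, covers a b -> 0 <= (f b : R) - f a <= 1)].
Arguments lipschitz_polytope R {d} P.

(* Main.v *)
Require Import Defs.
From HB Require Import structures.
From mathcomp Require Import all_boot all_order all_algebra.
From mathcomp Require Import all_classical all_reals all_analysis.
From mathcomp Require Import ring lra zify.

(* Write P^ for P with the bottom element adjoined and extend f : P -> R by 0 to
   P^, so that L(P) is cut out by 0 <= f y - f x <= 1 over the covers x < y of
   P^. The rank function q of P^ satisfies q y - q x = 1 on covers, hence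
   2 L(P) - q is the polytope U of all f with |f y - f x| <= 1 on covers. Strict
   inequalities between integers force an interior lattice point of U to be
   constant along covers, hence 0. L(P), and with it U, is a lattice polytope
   because rounding down coordinates, and rescaling their fractional parts,
   preserve the inequalities. Finally U is by definition the polar of the finite
   set of vectors 0, e_y - e_x, e_x - e_y, so by Farkas' lemma the polar of U is
   the convex hull of these vectors. *)

Set Implicit Arguments.
Unset Strict Implicit.
Unset Printing Implicit Defensive.

Import Order.TTheory GRing.Theory Num.Theory.
Import ArrowAsProduct.
Import numFieldNormedType.Exports.

Local Open Scope ring_scope.

(** * Covers, maximal chains and the rank function of a finite poset *)

Section Covers.
Context {d : Order.disp_t} {T : finPOrderType d}.
Implicit Types (x y z : T) (C D : {set T}).

Lemma covers_lt x y : covers x y -> (x < y)%O.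
Proof. by case/andP. Qed.

Lemma card_below_lt x y : (x < y)%O ->
  (#|[set z | (z < x)%O]| < #|[set z | (z < y)%O]|)%N.
Proof.
move=> xy; apply/proper_card/properP; split.
  by apply/fintype.subsetP => z; rewrite !inE => /lt_trans; apply.
by exists x; rewrite !inE ?ltxx.
Qed.

(** Among the elements below [y], one with the largest strict down-set works: anything between it
    and [y] would have a larger one. *)
Lemma lower_cover_exists x y : (x < y)%O -> exists z, covers z y.
Proof.
move=> xy; pose below z := #|[set w | (w < z)%O]|.
case: (arg_maxnP (P := fun z => z < y)%O below xy) => z zy zmax.
exists z; rewrite /covers zy /=; apply/existsP => -[w /andP[zw wy]].
by have := leq_ltn_trans (zmax w wy) (card_below_lt zw); rewrite ltnn.
Qed.

Lemma cover_ind (bot : T) (K : T -> Prop) :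
  (forall x, (bot <= x)%O) -> K bot ->
  (forall x y, covers x y -> K x -> K y) -> forall x, K x.
Proof.
move=> bot_le K0 KS x; have [n] := ubnP #|[set z | (z < x)%O]|.
elim: n x => // n IHn y yn.
have := bot_le y; rewrite le_eqVlt => /orP[/eqP<- //|/lower_cover_exists[x xy]].
apply: (KS _ _ xy); apply: IHn.
exact: leq_trans (card_below_lt (covers_lt xy)) yn.
Qed.

(** Both ends are comparable to every element of the interval, so adjoining them to [C] keeps it a
    chain, and maximality gives membership. *)
Lemma maximal_chain_ends x y C : (x <= y)%O -> maximal_chain x y C ->
  (x \in C) && (y \in C).
Proof.
move=> xy /maxsetP[/andP[/fintype.subsetP CI /forall_inP Cc] Cmax].
have mem z : (x <= z <= y)%O -> (forall w, w \in C -> (z >=< w)%O) -> z \in C.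
  move=> zI zc; rewrite -(Cmax (z |: C)) ?setU11 ?finset.subsetUr //; apply/andP; split.
    by apply/fintype.subsetP => w; rewrite in_setU1 => /orP[/eqP->|/CI //]; rewrite inE.
  apply/forall_inP => v; rewrite in_setU1 => /orP[/eqP->|vC];
    apply/forall_inP => w; rewrite in_setU1 => /orP[/eqP->|wC]; rewrite ?comparablexx //.
  - exact: zc.
  - by rewrite comparable_sym zc.
  - by have /forall_inP := Cc v vC; apply.
by apply/andP; split; apply: mem; rewrite ?lexx ?xy // => w /CI;
  rewrite inE => /andP[xw wy]; rewrite /Order.comparable ?xw ?wy ?orbT.
Qed.

(** Removing [y] from a larger chain [D] leaves a chain inside the interval up to [x], because
    nothing fits strictly between [x] and [y]; maximality of [C] then forces [D :\ y = C]. *)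
Lemma maximal_chain_cover a x y C : (a <= x)%O -> covers x y ->
  maximal_chain a x C -> maximal_chain a y (y |: C).
Proof.
move=> ax xy Cmc; have xlty := covers_lt xy.
have /andP[_ xC] := maximal_chain_ends ax Cmc.
move: Cmc => /maxsetP[/andP[/fintype.subsetP CI /forall_inP Cc] Cmax].
have Cle z : z \in C -> (a <= z <= x)%O by move/CI; rewrite inE.
have Clt z : z \in C -> (z < y)%O.
  by move/Cle => /andP[_ /le_lt_trans]; apply.
apply/maxsetP; split.
  apply/andP; split.
    apply/fintype.subsetP => w; rewrite in_setU1 inE => /orP[/eqP->|wC].
      by rewrite lexx (le_trans ax) // ltW.
    by rewrite (ltW (Clt _ wC)); case/andP: (Cle _ wC) => ->.
  apply/forall_inP => v; rewrite in_setU1 => /orP[/eqP->|vC];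
    apply/forall_inP => w; rewrite in_setU1 => /orP[/eqP->|wC]; rewrite ?comparablexx //.
  - by rewrite /Order.comparable (ltW (Clt _ wC)) orbT.
  - by rewrite /Order.comparable (ltW (Clt _ vC)).
  - by have /forall_inP := Cc v vC; apply.
move=> D /andP[/fintype.subsetP DI /forall_inP Dc] CD.
have yD : y \in D by apply: (fintype.subsetP CD); rewrite setU11.
have xD : x \in D by apply: (fintype.subsetP CD); rewrite setU1r.
suff DE : D :\ y = C by rewrite -DE finset.setD1K.
apply: Cmax; last first.
  apply/fintype.subsetP => z zC; rewrite in_setD1 (lt_eqF (Clt _ zC)) /=.
  by apply: (fintype.subsetP CD); rewrite setU1r.
apply/andP; split.
  apply/fintype.subsetP => z; rewrite in_setD1 => /andP[zy zD].
  have := DI z zD; rewrite !inE => /andP[-> zley] /=.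
  have zlty : (z < y)%O by rewrite lt_neqAle zy.
  have /forall_inP/(_ z zD) := Dc x xD.
  rewrite /Order.comparable => /orP[|//]; rewrite le_eqVlt => /orP[/eqP->//|xz].
  by case/andP: xy => _ /existsP[]; exists z; rewrite xz.
apply/forall_inP => v; rewrite in_setD1 => /andP[_ vD].
apply/forall_inP => w; rewrite in_setD1 => /andP[_ wD].
by have /forall_inP := Dc v vD; apply.
Qed.

(** The rank is the length of a chosen maximal chain from [bot]. Rankedness makes the choice
    irrelevant, so for a cover the chain of [x] with [y] added computes the rank of [y]. *)
Lemma ranked_rank_function (bot : T) : (forall x, (bot <= x)%O) -> ranked T ->
  exists2 rk : T -> nat, rk bot = 0%N &
    forall x y, covers x y -> rk y = (rk x).+1.
Proof.
move=> bot_le Trk.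
have chain_exists x : exists C, maximal_chain bot x C.
  have [|C Cmax _] := @maxset_exists _
    (fun D => (D \subset [set c | (bot <= c <= x)%O]) && is_chain D) finset.set0.
    by rewrite finset.sub0set; apply/forall_inP => y; rewrite inE.
  by exists C.
pose chain x := xchoose (chain_exists x).
have chainP x : maximal_chain bot x (chain x) by exact: xchooseP.
exists (fun x => #|chain x|.-1).
  rewrite (Trk bot bot (chain bot) [set bot]%SET) ?cards1 //.
  apply/maxsetP; split.
    apply/andP; split; first by apply/fintype.subsetP => z; rewrite !inE => /eqP->; rewrite lexx.
    by apply/forall_inP => v; rewrite inE => /eqP->; apply/forall_inP => w;
      rewrite inE => /eqP->; rewrite comparablexx.
  move=> D /andP[/fintype.subsetP DI _] bD; apply/eqP; rewrite finset.eqEsubset bD andbT.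
  by apply/fintype.subsetP => z /DI; rewrite !inE eq_sym => /le_anti->.
move=> x y xy; rewrite (Trk _ _ _ (y |: chain x) (chainP y)) //; last first.
  exact: maximal_chain_cover (bot_le x) xy _.
have /andP[bC _] := maximal_chain_ends (bot_le x) (chainP x).
rewrite cardsU1; have -> : y \notin chain x.
  apply/negP; case/maxsetP: (chainP x) => /andP[/fintype.subsetP CI _] _ /CI.
  by rewrite inE => /andP[_]; rewrite (lt_geF (covers_lt xy)).
(* The chain contains [bot], so its cardinality is positive and the predecessor is not truncated. *)
by rewrite prednK // card_gt0; apply/set0Pn; exists bot.
Qed.

End Covers.

(** * Farkas' lemma for finitely many linear functionals *)

Section Farkas.
Context {R : realFieldType} {V : lmodType R}.

(* Bartl's induction: a vector u violating the implication for the first m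
   functionals has a_m u > 0, and projecting along u onto the kernel of a_m
   eliminates a_m. *)
Lemma farkas (m : nat) (a : nat -> V -> R) (c : V -> R) :
  (forall i, scalar (a i)) -> scalar c ->
  (forall x, (forall i, (i < m)%N -> a i x <= 0) -> c x <= 0) ->
  exists2 l : nat -> R, forall i, 0 <= l i &
    forall x, c x = \sum_(i < m) l i * a i x.
Proof.
elim: m a c => [|m IHm] a c a_lin c_lin ac.
  exists (fun=> 0) => // x; rewrite big_ord0.
  have cN : c (- x) = - c x.
    have c0 : c 0 = 0 by have := c_lin (-1) 0 0; rewrite scaler0 addr0 mulN1r addNr.
    by have := c_lin (-1) x 0; rewrite addr0 scaleN1r c0 addr0 mulN1r.
  have c_le0 z : c z <= 0 by exact: ac.
  by have := c_le0 (- x); have := c_le0 x; rewrite cN; lra.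
have [acm|] := pselect (forall x, (forall i, (i < m)%N -> a i x <= 0) -> c x <= 0).
  have [l l0 cE] := IHm a c a_lin c_lin acm.
  exists (fun i => if (i < m)%N then l i else 0) => [i|x]; first by case: ifP.
  rewrite big_ord_recr /= ltnn mul0r addr0 cE.
  by apply: eq_bigr => i _; rewrite ltn_ord.
move=> /existsNP[u /not_implyP[au cu]].
have {}cu : 0 < c u by rewrite ltNge; apply/negP.
have amu : 0 < a m u.
  rewrite ltNge; apply/negP => amu; have : c u <= 0; last by rewrite leNgt cu.
  by apply: ac => i; rewrite ltnS leq_eqVlt => /orP[/eqP->|/au].
(* These functionals vanish at [u], and [a' m] vanishes identically. *)
pose a' i x := a i x - a i u / a m u * a m x.
pose c' x := c x - c u / a m u * a m x.
have [] := IHm a' c'.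
- by move=> i k x y; rewrite /a' !a_lin; ring.
- by move=> k x y; rewrite /c' !a_lin c_lin; ring.
- move=> x ax; pose t := - (a m x / a m u).
  have -> : c' x = c (t *: u + x) by rewrite c_lin /c' /t; ring.
  apply: ac => i; rewrite ltnS leq_eqVlt a_lin => /orP[/eqP->|im].
    by rewrite mulNr divfK ?gt_eqF // addNr.
  by have := ax i im; congr (_ <= _); rewrite /a' /t; ring.
move=> l l0 cE.
(* The weight of [a m] collects the multiples subtracted in [a'] and [c']; it is nonnegative since
   [a j u <= 0 < a m u] for [j < m] and [0 < c u]. *)
exists (fun i => if (i < m)%N then l i
                 else c u / a m u - \sum_(j < m) l j * (a j u / a m u)) => [i|x].
  case: ifP => // _; rewrite subr_ge0; apply: (@le_trans _ _ 0); last first.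
    by rewrite divr_ge0 // ltW.
  apply: sumr_le0 => j _; rewrite mulr_ge0_le0 // mulr_le0_ge0 ?au //.
  by rewrite invr_ge0 ltW.
rewrite big_ord_recr /= ltnn mulrBl mulr_suml.
rewrite addrCA -sumrB.
have -> : c x = c u / a m u * a m x + c' x by rewrite /c'; ring.
rewrite cE; congr (_ + _); apply: eq_bigr => i _.
by rewrite ltn_ord /a'; ring.
Qed.

End Farkas.

Local Open Scope classical_set_scope.

(** * Convex hulls, lattice polytopes and polar duality *)

Section Hulls.
Context {R : realType} {I : finType}.
Implicit Types (A S : set (I -> R^o)) (x y q : I -> R^o).

Lemma convex_setP A : @convex_set R (I -> R^o) A <->
  forall x y (t : R), 0 <= t -> t <= 1 -> A x -> A y -> A (t *: x + (1 - t) *: y).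
Proof.
split=> [cA x y t t0 t1 Ax Ay|cA x y t].
  have := cA x y (Itv01 t0 t1); rewrite !inE => /(_ Ax Ay).
  by [].
by rewrite !inE => Ax Ay; apply: cA.
Qed.

Lemma convex_hull_convex S : @convex_set R (I -> R^o) (convex_hull S).
Proof.
apply/convex_setP => x y t t0 t1 Sx Sy B [/= cB SB].
by move/convex_setP : (cB); apply => //; [apply: Sx|apply: Sy].
Qed.

(** Induction on [m]: the first [m] points are rescaled by their total weight [s] and mixed with the
    last one; if [s = 0], only the last point remains. *)
Lemma convex_combination A (m : nat) (l : nat -> R) (v : nat -> I -> R^o) :
  @convex_set R (I -> R^o) A -> (forall i, 0 <= l i) ->
  (forall i, (i < m)%N -> A (v i)) -> \sum_(i < m) l i = 1 ->
  A (\sum_(i < m) l i *: v i).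
Proof.
move=> /convex_setP cA l0; elim: m l l0 => [|m IHm] l l0 vA.
  by rewrite big_ord0 => /eqP; rewrite eq_sym oner_eq0.
rewrite !big_ord_recr /=; set s := \sum_(i < m) l i => sl.
have s0 : 0 <= s by apply: sumr_ge0.
have [s_eq0|s_neq0] := eqVneq s 0.
  have lm1 : l m = 1 by move: sl; rewrite s_eq0 add0r.
  have li0 (i : 'I_m) : l i = 0.
    by have /eqP := s_eq0; rewrite psumr_eq0 // => /allP/(_ i (mem_index_enum _))/eqP.
  rewrite lm1 scale1r big1 ?add0r; last by move=> i _; rewrite li0 scale0r.
  exact: vA.
have -> : \sum_(i < m) l i *: v i = s *: \sum_(i < m) (l i / s) *: v i.
  rewrite scaler_sumr; apply: eq_bigr => i _.
  by rewrite scalerA mulrCA divff // mulr1.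
have -> : l m = 1 - s by rewrite -sl; ring.
apply: cA => //.
- by rewrite -sl lerDl.
- apply: (IHm (fun i => l i / s)) => [i|i im|]; first exact: divr_ge0.
    by apply: vA; rewrite ltnS ltnW.
  by rewrite -mulr_suml divff.
- exact: vA.
Qed.

Lemma translateK A q : translate (translate A q) (- q) = A :> set (I -> R^o).
Proof.
apply/seteqP; split=> [_ [_ [f Af <-] <-]|f Af]; first by rewrite addrK.
by exists (f + q); [exists f|rewrite addrK].
Qed.

Lemma translate0 A : translate A 0 = A :> set (I -> R^o).
Proof.
apply/seteqP; split=> [_ [f Af <-]|f Af]; first by rewrite addr0.
by exists f; rewrite ?addr0.
Qed.

Lemma lattice_polytope_dilate_translate (r : nat) A q :
  lattice q -> lattice_polytope A -> lattice_polytope (translate (dilate r A) q).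
Proof.
move=> qZ [S [Sfin SZ ->]]; exists (translate (dilate r S) q); split.
- by do 2 apply: finite_image.
- move=> _ [_ [x Sx <-] <-] i; rewrite /= rpredD ?qZ // rpredM ?SZ //.
  exact: natr_int.
apply/seteqP; split.
  move=> _ [_ [x Sx <-] <-] B [/convex_setP cB SB].
  (* The hull is tested against the preimage of [B] under the affine map, which is again convex. *)
  apply: (Sx [set z | B (r%:R *: z + q)]); split => /=.
    apply/convex_setP => z w t t0 t1 /= Bz Bw.
    have := cB _ _ _ t0 t1 Bz Bw; congr B.
    apply/funext => i; rewrite /= !fctE /GRing.scale /=; ring.
  by move=> z Sz; apply: SB; exists (r%:R *: z) => //; exists z.
apply: smallest_sub.
  apply/convex_setP => _ _ t t0 t1 [_ [x Sx <-] <-] [_ [y Sy <-] <-].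
  exists (r%:R *: (t *: x + (1 - t) *: y)).
    exists (t *: x + (1 - t) *: y) => //.
    by have /convex_setP := @convex_hull_convex S; apply.
  by apply/funext => i; rewrite /= !fctE /GRing.scale /=; ring.
by move=> _ [_ [x Sx <-] <-]; exists (r%:R *: x) => //; exists x => //; exact: sub_gen_smallest.
Qed.

Definition dot x y : R := \sum_i (x i : R) * y i.

Lemma dot_scalar x : scalar (dot x).
Proof.
move=> k y z; rewrite /dot mulr_sumr -big_split; apply: eq_bigr => i _ /=.
by rewrite !fctE /GRing.scale /=; ring.
Qed.

Lemma dotC x y : dot x y = dot y x.
Proof. by apply: eq_bigr => i _; rewrite mulrC. Qed.

Lemma dotZr x k y : dot x (k *: y) = k * dot x y.
Proof. by rewrite /dot mulr_sumr; apply: eq_bigr => i _; rewrite mulrCA. Qed.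

Lemma dot0r x : dot x 0 = 0.
Proof. by rewrite /dot big1 // => i _; rewrite mulr0. Qed.

Lemma dot_sumr x (m : nat) (l : nat -> R) (v : nat -> I -> R^o) :
  dot x (\sum_(i < m) l i *: v i) = \sum_(i < m) l i * dot x (v i).
Proof.
elim: m => [|m IHm]; first by rewrite !big_ord0 dot0r.
by rewrite !big_ord_recr /= addrC dot_scalar IHm addrC.
Qed.

Lemma dot_inj x y : (forall z, dot z x = dot z y) -> x = y.
Proof.
move=> xy; apply/funext => i.
have dotE w : dot (fun j => (j == i)%:R) w = w i.
  rewrite /dot (bigD1 i) //= eqxx mul1r big1 ?addr0 // => j /negPf->.
  by rewrite mul0r.
by rewrite -!dotE.
Qed.

Lemma polar_convex A : @convex_set R (I -> R^o) (polar A).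
Proof.
apply/convex_setP => f g t t0 t1 fA gA h Ah.
have := fA h Ah; have := gA h Ah; rewrite -!/(dot _ _).
by rewrite (dotC (_ + _)) dot_scalar dotZr !(dotC h); nra.
Qed.

(* Farkas' lemma is applied to the functionals (x, t) |-> dot w x - t. *)
Lemma bipolar S : finite_set S -> S 0 -> polar (polar S) `<=` convex_hull S.
Proof.
move=> /finite_seqP[s ->] /= S0 y yP.
pose v i := nth 0 s i; pose V := ((I -> R^o) * R^o)%type.
pose a (w : I -> R^o) (p : V) : R := dot w p.1 - p.2.
have a_lin w : scalar (a w).
  by move=> k p p'; rewrite /a /= dot_scalar /GRing.scale /=; ring.
have [|l l0 lE] := @farkas R V (size s) (fun i => a (v i)) (a y)
    (fun i => a_lin (v i)) (a_lin y).
  move=> [x t] av.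
  have {}av w : w \in s -> dot w x <= t.
    rewrite -index_mem => ws; have := av _ ws.
    by rewrite /a /v nth_index -?index_mem //= subr_le0.
  have t0 : 0 <= t by have := av 0 S0; rewrite dotC dot0r.
  (* As [t] bounds [dot w x] for all [w] in [s], the point [k *: x] lies in the polar once
     [k * t <= 1]. *)
  have scaled k : 0 <= k -> k * t <= 1 -> k * dot y x <= 1.
    move=> k0 kt; rewrite -dotZr; apply: yP => w /= ws.
    rewrite -/(dot _ _) dotC dotZr; apply: le_trans kt.
    by rewrite ler_wpM2l // av.
  rewrite /a /= subr_le0 leNgt; apply/negP => tD.
  have tD0 : 0 < t + dot y x by lra.
  (* With this scale [k * t] and [k * dot y x] average to 1, so the smaller one is below 1 and the
     larger one above, even if [t = 0]. *)
  pose k := 2 / (t + dot y x).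
  have kE : k * t + k * dot y x = 2 by rewrite -mulrDr divfK ?gt_eqF.
  have k0 : 0 < k by rewrite divr_gt0.
  have ktD : k * t < k * dot y x by rewrite ltr_pM2l.
  have kt1 : k * t <= 1 by lra.
  have := scaled k (ltW k0) kt1; lra.
(* The Farkas identity at [(z, 0)] recovers [y]; at [(0, -1)] it shows that the weights sum to 1. *)
have -> : y = \sum_(i < size s) l i *: v i.
  apply: dot_inj => z; rewrite dot_sumr.
  have := lE (z, 0); rewrite /a /= subr0 dotC => ->.
  by apply: eq_bigr => i _; rewrite subr0 dotC.
apply: convex_combination => //; first exact: convex_hull_convex.
  by move=> i im; apply: sub_gen_smallest; exact: mem_nth.
have aE w : a w (0, -1) = 1 by rewrite /a /= dot0r; ring.
have := lE (0, -1); rewrite aE => ->.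
by apply: eq_bigr => i _; rewrite aE mulr1.
Qed.

End Hulls.

(** * Rounding down and rescaling fractional parts *)

Section FractionalScaling.
Context {R : realType}.
Implicit Types u v l : R.

Definition scale_frac l u : R := (Num.floor u)%:~R + (u - (Num.floor u)%:~R) / l.

Lemma frac_itv u : 0 <= u - (Num.floor u)%:~R < 1.
Proof. by have := floor_itv u; rewrite intrD mulr1z; lra. Qed.

Lemma scale_frac_int l u : u \is a Num.int -> scale_frac l u = u.
Proof.
by rewrite intrEfloor /scale_frac => /eqP->; rewrite subrr mul0r addr0.
Qed.

Lemma floor_scale_frac_convex l u : l != 0 ->
  u = l * scale_frac l u + (1 - l) * (Num.floor u)%:~R.
Proof. by move=> l0; rewrite /scale_frac mulrDr mulrCA divff //; ring. Qed.

(** The floors differ by an integer strictly between -1 and 2, hence by 0 or 1. In the first case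
    [q - p] lies in [[0, l]], in the second [p - q] does, and division by [l] lands in [[0, 1]]. *)
Lemma floor_scale_frac_diff l u v : 0 < l ->
  u - (Num.floor u)%:~R <= l -> v - (Num.floor v)%:~R <= l ->
  0 <= v - u <= 1 ->
  (0 <= ((Num.floor v)%:~R - (Num.floor u)%:~R : R) <= 1) /\
  0 <= scale_frac l v - scale_frac l u <= 1.
Proof.
rewrite /scale_frac => l0 ul vl uv.
have := frac_itv u; have := frac_itv v.
set m := Num.floor u in ul *; set k := Num.floor v in vl *.
set p := u - _ in ul *; set q := v - _ in vl * => /andP[q0 q1] /andP[p0 p1].
have kmE : (k - m)%:~R = (v - u) - (q - p) :> R by rewrite intrB /p /q; ring.
have km1 : -1 < k - m by rewrite -(ltr_int R) kmE; lra.
have km2 : k - m < 2 by rewrite -(ltr_int R) kmE; lra.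
have ratio w : 0 <= w -> w <= l -> 0 <= w / l <= 1.
  by move=> w0 wl; rewrite divr_ge0 ?(ltW l0) //= ler_pdivrMr // mul1r.
have ratioB : q / l - p / l = (q - p) / l by rewrite -mulrBl.
rewrite opprD addrACA ratioB -intrB.
have [km|km] : k - m = 0 \/ k - m = 1 by lia.
- rewrite km in kmE *; have := ratio (q - p); lra.
- rewrite km in kmE *; have := ratio (p - q).
  by rewrite -(opprB q p) mulNr; lra.
Qed.

End FractionalScaling.

(** * The Lipschitz polytope as a lattice polytope *)

Section LipschitzPolytope.
Context {R : realType} {d : Order.disp_t} {P : finPOrderType d}.
Implicit Types (f g c : P -> R^o) (x y : adjoin_bot P).

Definition ext f x : R := if x is Some a then f a else 0.

Lemma bot_le x : ((None : adjoin_bot P) <= x)%O. Proof. by []. Qed.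

Lemma some_lt (a b : P) : (Some a < Some b :> adjoin_bot P)%O = (a < b)%O.
Proof. by rewrite !lt_def. Qed.

Lemma covers_bot (b : P) : covers (None : adjoin_bot P) (Some b) = minimal_elt b.
Proof.
rewrite /covers /minimal_elt lt_def /=; congr negb; apply/existsP/existsP.
  by case=> -[c|] /andP[]; rewrite ?ltxx // some_lt; exists c.
by case=> c cb; exists (Some c); rewrite some_lt cb lt_def.
Qed.

Lemma covers_some (a b : P) : covers (Some a : adjoin_bot P) (Some b) = covers a b.
Proof.
rewrite /covers some_lt; congr (_ && ~~ _); apply/existsP/existsP.
  by case=> -[c|] /andP[]; rewrite ?some_lt // => ac cb; exists c; rewrite ac.
by case=> c /andP[ac cb]; exists (Some c); rewrite !some_lt ac.
Qed.

(** Minimal elements are exactly the covers of the adjoined bottom, where [ext] is 0, so both kinds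
    of constraints become one. *)
Lemma lipschitz_polytopeP f : lipschitz_polytope R P f <->
  forall x y, covers x y -> 0 <= ext f y - ext f x <= 1.
Proof.
split=> [[f0 f1] [a|] [b|] //|fc].
- by rewrite covers_some; apply: f1.
- by rewrite covers_bot subr0; apply: f0.
split=> [a a_min|a b ab]; last by apply: (fc (Some a) (Some b)); rewrite covers_some.
by have := fc None (Some a); rewrite covers_bot /= subr0; apply.
Qed.

Lemma extD f g x : ext (f + g) x = ext f x + ext g x.
Proof. by case: x => //=; rewrite addr0. Qed.

Lemma extZ (k : R) f x : ext (k *: f) x = k * ext f x.
Proof. by case: x => //=; rewrite mulr0. Qed.

Lemma extN f x : ext (- f) x = - ext f x.
Proof. by case: x => //=; rewrite oppr0. Qed.

Lemma ext_comp (h : R -> R) f x : h 0 = 0 -> ext (fun a => h (f a)) x = h (ext f x).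
Proof. by case: x. Qed.

Lemma lipschitz_polytope_convex :
  @convex_set R (P -> R^o) (lipschitz_polytope R P).
Proof.
apply/convex_setP => f g t t0 t1 /lipschitz_polytopeP fL /lipschitz_polytopeP gL.
apply/lipschitz_polytopeP => x y xy; rewrite !extD !extZ.
have /andP[f0 f1] := fL x y xy; have /andP[g0 g1] := gL x y xy.
have -> : t * ext f y + (1 - t) * ext g y - (t * ext f x + (1 - t) * ext g x)
        = t * (ext f y - ext f x) + (1 - t) * (ext g y - ext g x) by ring.
nra.
Qed.

(* Averaging the componentwise floor of f with the point obtained by scaling all
   fractional parts so that the largest becomes 1 recovers f; the latter point
   has fewer nonintegral coordinates. *)
Lemma lipschitz_polytope_sub_hull :
  lipschitz_polytope R P `<=` convex_hull (lipschitz_polytope R P `&` lattice).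
Proof.
move=> f; have [n] := ubnP #|[set a | (f a : R) \isn't a Num.int]%SET|.
elim: n f => // n IHn f fn fL.
have [/forallP fZ|] := boolP [forall a, (f a : R) \is a Num.int].
  exact: sub_gen_smallest.
rewrite negb_forall => /existsP[a1 a1Z].
pose frac a : R := (f a : R) - (Num.floor (f a))%:~R.
have [a0 _ a0max] := @arg_maxP _ R _ a1 xpredT frac isT.
set l := frac a0.
have l0 : 0 < l.
  apply: lt_le_trans (a0max a1 isT); rewrite lt_neqAle eq_sym subr_eq0 eq_sym.
  by rewrite -intrEfloor a1Z; have /andP[] := frac_itv (f a1 : R).
have l1 : l < 1 by have /andP[] := frac_itv (f a0 : R).
have fracl x : ext f x - (Num.floor (ext f x))%:~R <= l.
  by case: x => [a|] /=; [exact: a0max|rewrite floor0 subrr ltW].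
have steps x y (xy : covers x y) := floor_scale_frac_diff l0 (fracl x) (fracl y)
  ((lipschitz_polytopeP f).1 fL x y xy).
pose g a : R^o := (Num.floor (f a))%:~R; pose h a : R^o := scale_frac l (f a).
have -> : f = l *: h + (1 - l) *: g.
  by apply/funext => a; rewrite {1}(floor_scale_frac_convex (f a) (lt0r_neq0 l0)).
have /convex_setP := @convex_hull_convex _ _ (lipschitz_polytope R P `&` lattice).
apply; rewrite ?ltW //.
  apply: IHn; last first.
    apply/lipschitz_polytopeP => x y xy.
    rewrite !(ext_comp _ _ (scale_frac_int l (rpred0 _))).
    by have [] := steps x y xy.
  move: fn; rewrite ltnS; apply: leq_trans; apply: proper_card; apply/properP; split.
    apply/fintype.subsetP => a; rewrite !inE; apply: contra => fa.
    by rewrite /h scale_frac_int.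
  (* The fractional part at [a0] is [l] itself, so it is scaled to 1 and this coordinate becomes
     integral. *)
  exists a0; rewrite !inE ?negbK.
    by rewrite intrEfloor eq_sym -subr_eq0 gt_eqF.
  by rewrite /h /scale_frac -/(frac a0) divff ?gt_eqF // rpredD // ?rpred1 // intr_int.
apply: sub_gen_smallest; split; last by move=> a; exact: intr_int.
apply/lipschitz_polytopeP => x y xy.
rewrite !(@ext_comp (fun u => (Num.floor u)%:~R)) ?floor0 //.
by have [] := steps x y xy.
Qed.

Lemma lipschitz_polytope_lattice : lattice_polytope (lipschitz_polytope R P).
Proof.
exists (lipschitz_polytope R P `&` lattice); split.
- pose N := #|{: adjoin_bot P}|.
  pose below x := #|[set z | (z < x)%O]%SET|.
  (* Climbing a cover raises [f] by at most 1 and the size of the down-set by at least 1; hence only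
     finitely many integer points occur. *)
  have bound f : lipschitz_polytope R P f ->
      forall x, 0 <= ext f x <= (below x)%:R.
    move=> /lipschitz_polytopeP fL; apply: cover_ind bot_le _ _ => /=.
      by rewrite lexx ler0n.
    move=> x y xy fx; have := fL x y xy.
    have : ((below x).+1%:R <= (below y)%:R :> R).
      by rewrite ler_nat; apply/card_below_lt/covers_lt.
    by rewrite -natr1; lra.
  apply: (@sub_finite_set _ _
    [set (fun a => (k a : nat)%:R : R^o) | k in [set: {ffun P -> 'I_N.+1}]]).
    move=> f [fL fZ].
    have /choice[k kP] a : exists k : 'I_N.+1, (f a : R) = (k : nat)%:R.
      have /andP[f0 fN] := bound f fL (Some a).
      have /natrP[k fk] : (f a : R) \is a Num.nat by rewrite natrEint fZ.
      suff kN : (k < N.+1)%N by exists (Ordinal kN).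
      by rewrite ltnS -(ler_nat R) -fk (le_trans fN) // ler_nat max_card.
    by exists [ffun a => k a] => //; apply/funext => a; rewrite ffunE -kP.
  by apply: finite_image; exact: finite_finset.
- exact: subIsetr.
- apply/seteqP; split; first exact: lipschitz_polytope_sub_hull.
  apply: smallest_sub; last exact: subIsetl.
  exact: lipschitz_polytope_convex.
Qed.

End LipschitzPolytope.

(** * The centered polytope, its interior lattice points and its polar *)

Section UnitPolytope.
Context {R : realType} {d : Order.disp_t} {P : finPOrderType d}.
Implicit Types (f g c : P -> R^o) (x y : adjoin_bot P).

Definition unit_polytope : set (P -> R^o) :=
  [set f | forall x y, covers x y -> `|ext f y - ext f x| <= 1].

(** Since [c] grows by 1 along covers, passing from [f] to [2 f - c] turns increments in [[0, 1]]
    into increments in [[-1, 1]], and conversely. *)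
Lemma dilate2_lipschitz_polytope c :
  (forall x y, covers x y -> ext c y = ext c x + 1) ->
  dilate 2 (lipschitz_polytope R P) = translate unit_polytope c.
Proof.
move=> c1; apply/seteqP; split.
  move=> _ [f /lipschitz_polytopeP fL <-]; exists (2%:R *: f - c); last by rewrite subrK.
  move=> x y xy; rewrite !extD !extZ !extN ler_norml.
  by have := fL x y xy; have := c1 x y xy; lra.
move=> _ [f fU <-]; exists (2%:R^-1 *: (f + c)); last first.
  by rewrite scalerA divff ?scale1r // pnatr_eq0.
apply/lipschitz_polytopeP => x y xy; rewrite !extZ !extD.
by have := fU x y xy; rewrite ler_norml; have := c1 x y xy; lra.
Qed.

(** Any [f] is an affine combination of 0 and its shrunken copy [t^-1 *: f], both in the
    polytope. *)
Lemma unit_polytope_full_dimensional : full_dimensional unit_polytope.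
Proof.
apply/seteqP; split=> // f _ A [/= A_aff UA].
(* Differences of values of [ext f] are at most [s + s]; the extra 1 keeps [t] positive when
   [f = 0]. *)
pose s : R := \sum_a `|f a : R|; pose t := 1 + (s + s).
have s0 : 0 <= s by apply: sumr_ge0.
have t0 : 0 < t by rewrite /t; lra.
have fs x : `|ext f x| <= s.
  case: x => [a|] /=; last by rewrite normr0.
  by rewrite /s (bigD1 a) //= lerDl sumr_ge0.
have -> : f = t *: (t^-1 *: f) + (1 - t) *: 0.
  by rewrite scalerA divff ?gt_eqF // scale1r scaler0 addr0.
apply: A_aff; apply: UA => x y _; last by case: x y => [?|] [?|]; rewrite /= subrr normr0.
rewrite !extZ -mulrBr normrM gtr0_norm ?invr_gt0 // mulrC ler_pdivrMr // mul1r.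
apply: le_trans (ler_normB _ _) _.
by have := fs x; have := fs y; rewrite /t; lra.
Qed.

(** Moving each of the finitely many coordinates by less than 1/2 changes every difference by at
    most 1. *)
Lemma center_interior c : (translate unit_polytope c)° c.
Proof.
have half0 : 0 < 2^-1 :> R by rewrite invr_gt0.
have near_c (a : P) : \forall f \near c, `|(c a : R) - f a| < 2^-1.
  exact: (@proj_continuous P (fun=> R^o) a c _ (nbhsx_ballx (c a : R^o) 2^-1 half0)).
apply: filterS (filter_forall _ near_c) => f fc.
exists (f - c); last by rewrite subrK.
have le_half x : `|ext (f - c) x| <= 2^-1.
  case: x => [a|] /=; last by rewrite normr0 ltW.
  by rewrite distrC ltW // fc.
move=> x y _; apply: le_trans (ler_normB _ _) _.
by have := le_half x; have := le_half y; lra.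
Qed.

(** From an interior point the coordinate at the upper end of a cover can move by [e / 2] both ways
    inside the polytope, so the weak bound has slack. *)
Lemma interior_lt1 c f : (translate unit_polytope c)° f ->
  forall x y, covers x y -> `|ext (f - c) y - ext (f - c) x| < 1.
Proof.
move=> f_int x [b|] xb; last first.
  by have := le_lt_trans (bot_le x) (covers_lt xb); rewrite ltxx.
pose move_b (u : R^o) : P -> R^o := dfwith f b u.
have move_bE : move_b (f b) = f.
  by apply/funext => a; rewrite /move_b; case: dfwithP.
have : \forall u \near (f b : R^o), translate unit_polytope c (move_b u).
  by apply: (@dfwith_continuous P (fun=> R^o) f b (f b)); rewrite -/(move_b _) move_bE.
move=> /nbhs_ballP[e /= e0 eU].
have near_le1 u : `|u| < e -> `|ext (f - c) (Some b) + u - ext (f - c) x| <= 1.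
  move=> ue; have [|g gU gE] := eU (f b + u : R).
    by rewrite /ball /= opprD addrA subrr sub0r normrN.
  have {gE} gE : g = move_b (f b + u) - c by rewrite -gE addrK.
  have := gU _ _ xb; rewrite gE /= !fctE /move_b dfwithin.
  case: x xb => [a|] xb; last by congr (`|_| <= 1); rewrite /=; ring.
  have ab : b != a by apply: contraTneq xb => ->; rewrite /covers ltxx.
  by rewrite /= dfwithout //; congr (`|_| <= 1); rewrite /=; ring.
have := near_le1 (e / 2); have := near_le1 (- (e / 2)).
rewrite normrN gtr0_norm ?divr_gt0 // !ler_norml ltr_norml.
have e2 : e / 2 < e by lra.
by move=> /(_ e2) /= ? /(_ e2) /= ?; lra.
Qed.

(** Serves twice: with the rank function for the doubled polytope, and with 0 for reflexivity. *)
Lemma lattice_interior c : lattice c ->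
  lattice `&` (translate unit_polytope c)° = [set c].
Proof.
move=> cZ; apply/seteqP; split; last by move=> _ ->; split=> //; exact: center_interior.
move=> f [fZ /interior_lt1 f_lt1].
have fcZ x : ext (f - c) x \is a Num.int.
  by case: x => [a|] /=; [rewrite rpredB ?fZ ?cZ|exact: rpred0].
suff fc0 x : ext (f - c) x = 0.
  by apply/funext => a; apply/eqP; rewrite -subr_eq0; apply/eqP; exact: (fc0 (Some a)).
move: x; apply: cover_ind bot_le _ _ => // x y xy fx0.
have := f_lt1 x y xy; rewrite fx0 subr0 => fy1.
by apply/eqP; apply: contraLR fy1 => /(norm_intr_ge1 (fcZ y)); rewrite -leNgt.
Qed.

(** Represents evaluation of [ext] at [x] under [dot]; the bottom gets 0 because [ext] vanishes
    there. *)
Definition indicator x : P -> R^o := if x is Some a then fun b => (b == a)%:R else 0.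

Definition edge x y : P -> R^o := indicator y - indicator x.

Lemma dot_indicator f x : dot f (indicator x) = ext f x.
Proof.
case: x => [a|] /=; last exact: dot0r.
by rewrite /dot (bigD1 a) //= eqxx mulr1 big1 ?addr0 // => b /negPf->; rewrite mulr0.
Qed.

Lemma dot_edge f x y : dot f (edge x y) = ext f y - ext f x.
Proof.
by rewrite /edge addrC -scaleN1r dot_scalar !dot_indicator mulN1r addrC.
Qed.

(* The diagonal pairs only contribute the vector 0. *)
Definition edges : set (P -> R^o) :=
  [set edge p.1 p.2 | p in [set p : adjoin_bot P * adjoin_bot P |
    [|| covers p.1 p.2, covers p.2 p.1 | p.1 == p.2]]].

(** The two orientations of a cover give the two one-sided bounds behind the absolute value. *)
Lemma polar_edges : polar edges = unit_polytope.
Proof.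
apply/seteqP; split=> [f fE x y xy|f fU _ [[x y] /= xy <-]].
  have e1 : dot f (edge x y) <= 1.
    by apply: fE; exists (x, y) => //=; rewrite xy.
  have e2 : dot f (edge y x) <= 1.
    by apply: fE; exists (y, x) => //=; rewrite xy orbT.
  by move: e1 e2; rewrite !dot_edge ler_norml; lra.
rewrite -/(dot _ _) dot_edge; case/or3P: xy => [/fU|/fU|/eqP->].
- by rewrite ler_norml; lra.
- by rewrite ler_norml; lra.
- by rewrite subrr.
Qed.

Lemma polar_unit_polytope_lattice : lattice_polytope (polar unit_polytope).
Proof.
have edges_fin : finite_set edges by apply: finite_image; exact: finite_finset.
exists edges; split=> //.
  move=> _ [[x y] _ <-] a /=; rewrite rpredB //.
    by case: y => [b|] /=; rewrite ?natr_int ?rpred0.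
  by case: x => [b|] /=; rewrite ?natr_int ?rpred0.
rewrite -polar_edges; apply/seteqP; split.
  (* The diagonal pair supplies the point 0 that [bipolar] asks for. *)
  apply: bipolar => //; exists (None, None); rewrite /= ?eqxx ?orbT //.
  exact: subrr.
apply: smallest_sub; first exact: polar_convex.
by move=> e Ee f fE; have := fE e Ee; under eq_bigr do rewrite mulrC.
Qed.

End UnitPolytope.

Theorem proposition4p2 (R : realType) (d : Order.disp_t) (P : finPOrderType d) :
  connected_poset P -> ranked (adjoin_bot P) ->
  gorenstein 2 (lipschitz_polytope R P).
Proof.
move=> _ /(ranked_rank_function bot_le)[rk rk0 rkS].
(* The center is the rank function; as the adjoined bottom has rank 0, [ext c] agrees with the rank
   everywhere. *)
pose c (a : P) : R^o := (rk (Some a))%:R.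
have cE x : ext c x = (rk x)%:R by case: x => //=; rewrite rk0.
have cZ : lattice c by move=> a; exact: natr_int.
have dilE : dilate 2 (lipschitz_polytope R P) = translate unit_polytope c.
  by apply: dilate2_lipschitz_polytope => x y /rkS; rewrite !cE => ->; rewrite -natr1.
have L_lat := @lipschitz_polytope_lattice R d P.
split=> //; exists c; split; first by rewrite dilE lattice_interior.
have := @lattice_polytope_dilate_translate R P 2 _ (- c) _ L_lat.
rewrite dilE translateK => U_lat; split.
- by apply: U_lat => a; rewrite rpredN cZ.
- exact: unit_polytope_full_dimensional.
- by rewrite -{1}[unit_polytope]translate0 lattice_interior // => a; exact: rpred0.
- exact: polar_unit_polytope_lattice.
Qed.
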